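(* There exists a mixing measure preserving system $(X,\mathcal{X},\mu,T)$ that has a strictly under-recurrent set and a strictly over-recurrent set; that is, there exist sets $A,B\in\mathcal{X}$ with $0<\mu(A)<1$ and $0<\mu(B)<1$ such that $\mu(A\cap T^{-n}A)<\mu(A)^2$ for every $n\in\mathbb{N}$ and $\mu(B\cap T^{-n}B)>\mu(B)^2$ for every $n\in\mathbb{N}$.
   Context: A measure preserving system is a quadruple $(X,\mathcal{X},\mu,T)$ where $(X,\mathcal{X},\mu)$ is a probability space and $T\colon X\to X$ is a measure preserving transformation. $\mathbb{N}=\{1,2,\ldots\}$. The system is mixing if $\lim_{n\to\infty}\mu(C\cap T^{-n}D)=\mu(C)\mu(D)$ for all $C,D\in\mathcal{X}$. *)

(* Defs.v *)
From HB Require Import structures.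
From mathcomp Require Import all_boot all_order all_algebra.
From mathcomp Require Import all_classical all_reals all_analysis.

Set Implicit Arguments.
Unset Strict Implicit.
Unset Printing Implicit Defensive.

Import Order.TTheory GRing.Theory Num.Theory.
Import numFieldNormedType.Exports.

Local Open Scope classical_set_scope.
Local Open Scope ring_scope.
Local Open Scope ereal_scope.

Section MeasurePreservingSystems.
Context (R : realType) (d : measure_display) (X : measurableType d).
Variables (mu : probability X R) (T : X -> X).

Definition measure_preserving : Prop :=
  measurable_fun setT T /\
  forall C : set X, measurable C -> mu (T @^-1` C) = mu C.

(* T^{-n} D is the preimage of D under the n-th iterate; T need not be
   invertible. *)
Definition mixing : Prop :=
  forall C D : set X, measurable C -> measurable D ->
    mu (C `&` iter n T @^-1` D) @[n --> \oo] --> mu C * mu D.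

(* Return times range over the positive integers. *)
Definition strictly_under_recurrent (A : set X) : Prop :=
  forall n : nat, (0 < n)%N -> mu (A `&` iter n T @^-1` A) < mu A ^+ 2.

Definition strictly_over_recurrent (B : set X) : Prop :=
  forall n : nat, (0 < n)%N -> mu B ^+ 2 < mu (B `&` iter n T @^-1` B).

End MeasurePreservingSystems.

(* Main.v *)
(* The system is the doubling map on [0, 1] with Lebesgue measure; the
   over-recurrent set is [0, 1/3) and the under-recurrent one its translate
   [1/2, 5/6). Since 0 and 1/2 have the same image, correlations of both sets
   reduce to the measures of [0, a) & T^-n D with a = 1/3 and a = 2/3, which
   satisfy a linear recurrence because 2 * 1/3 = 2/3 and 2 * 2/3 = 1/3 mod 1.
   For arbitrary a, the same halving shows that the measure of [0, a) & T^-n D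
   is within 2^-n of a * mu D; half-lines form a pi-system generating the Borel
   sets, so this gives mixing. *)
Require Import Defs.
From mathcomp Require Import all_boot all_order all_algebra.
From mathcomp Require Import all_classical all_reals all_analysis.
From mathcomp Require Import measurable_realfun ring lra.

Set Implicit Arguments.
Unset Strict Implicit.
Unset Printing Implicit Defensive.

Import Order.TTheory GRing.Theory Num.Theory.
Import numFieldNormedType.Exports.

Local Open Scope classical_set_scope.
Local Open Scope ring_scope.
Local Open Scope ereal_scope.

Lemma preimage_iterS (X : Type) (T : X -> X) n (D : set X) :
  iter n.+1 T @^-1` D = T @^-1` (iter n T @^-1` D).
Proof. by apply/funext => x /=; rewrite -iterS iterSr. Qed.

(** * Mixing tested on a generating pi-system *)

Section MixingFromPiSystem.
Context (R : realType) (d : measure_display) (X : measurableType d).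
Variables (mu : probability X R) (T : X -> X).
Hypothesis mpT : measure_preserving mu T.

Lemma measurable_iter_preimage n D :
  measurable D -> measurable (iter n T @^-1` D).
Proof.
elim: n D => // n IHn D mD.
rewrite preimage_iterS -[X in measurable X]setTI.
by apply: mpT.1 => //; exact: IHn.
Qed.

Lemma measure_iter_preimage n D :
  measurable D -> mu (iter n T @^-1` D) = mu D.
Proof.
elim: n D => // n IHn D mD.
by rewrite preimage_iterS mpT.2 ?IHn//; exact: measurable_iter_preimage.
Qed.

(** Dynkin induction in the first set only, with [D] fixed and arbitrary. Invariance of [mu] settles
    the full set, subtraction from [mu D] settles complements, and countable disjoint unions follow
    by approximation with finite ones. *)
Lemma mixing_pi_system (G : set (set X)) :
  @measurable _ X = <<s G >> -> setI_closed G ->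
  (forall C D, G C -> measurable D ->
    mu (C `&` iter n T @^-1` D) @[n --> \oo] --> mu C * mu D) ->
  mixing mu T.
Proof.
move=> GE GI cvgG C D mC mD.
pose P (E : set X) := mu (E `&` iter n T @^-1` D) @[n --> \oo] --> mu E * mu D.
have mTD n : measurable (iter n T @^-1` D) by exact: measurable_iter_preimage.
have fin (E : set X) : measurable E -> mu E \is a fin_num.
  by move=> mE; exact: fin_num_measure.
have PU A B : measurable A -> measurable B -> A `&` B = set0 ->
    P A -> P B -> P (A `|` B).
  move=> mA mB AB0 PA PB; rewrite /P.
  rewrite (_ : (fun n => _) = fun n =>
      mu (A `&` iter n T @^-1` D) + mu (B `&` iter n T @^-1` D)); last first.
    apply/funext => n; rewrite setIUl measureU//.
    - exact: measurableI.
    - exact: measurableI.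
    - by rewrite setIACA AB0 set0I.
  rewrite measureU// ge0_muleDl//; apply: cvgeD => //.
  by rewrite fin_num_adde_defr// fin_numM// fin.
suff: P C by [].
move: mC; rewrite {1}GE; apply: (dynkin_induction GE GI).
- rewrite /P (_ : (fun n => _) = cst (mu D)).
    by rewrite probability_setT mul1e; exact: cvg_cst.
  by apply/funext => n; rewrite setTI measure_iter_preimage.
- by move=> E GEE; exact: cvgG.
- move=> E mE PE; rewrite /P.
  rewrite (_ : (fun n => _) = fun n =>
      mu D - mu (E `&` iter n T @^-1` D)); last first.
    apply/funext => n; rewrite setIC -setDE measureD// ?ltey_eq ?fin//.
    by congr (_ - _); [exact: measure_iter_preimage|rewrite setIC].
  rewrite probability_setC// muleBl ?fin// mul1e.
  by apply: (cvgeB _ (cvg_cst _) PE); rewrite fin_num_adde_defr// fin.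
- move=> F mF tF PF.
  (* The partial unions satisfy [P] by finite additivity, and their measures tend to that of the
     whole union by continuity from below. *)
  pose E N := \big[setU/set0]_(i < N.+1) F i.
  have mE N : measurable (E N) by exact: bigsetU_measurable.
  have mUF : measurable (\bigcup_k F k) by exact: bigcupT_measurable.
  have PE N : P (E N).
    elim: N => [|N IHN]; first by rewrite /E big_ord1; exact: PF.
    rewrite /E big_ord_recr; apply: PU => //=; first exact: mE.
    have tF' : trivIset (fun k => xpredT k) F by move=> i j _ _; exact: tF.
    exact: (trivIset_bigsetUI tF').
  have EU : mu (E N) @[N --> \oo] --> mu (\bigcup_k F k).
    have := @nondecreasing_cvg_mu _ _ _ mu E.
    rewrite /E bigcup_bigsetU_bigcup; apply => //.
    by move=> m n mn; apply/subsetPset; exact: subset_bigsetU.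
  have muM A : measurable A -> mu A * mu D = (fine (mu A) * fine (mu D))%:E.
    by move=> mA; rewrite EFinM !fineK// fin.
  rewrite /P muM//.
  apply/fine_cvgP; split.
    by apply: nearW => n; apply: fin; exact: measurableI.
  apply/cvgrPdist_le => e e0.
  have e3 : (0 < e / 3)%R by lra.
  have fU : mu (\bigcup_k F k) = (fine (mu (\bigcup_k F k)))%:E.
    by rewrite fineK// fin.
  move: EU; rewrite fU => /fine_cvgP[_] /cvgrPdist_le/(_ _ e3).
  case=> N _ /(_ N (leqnn N))/= EN.
  have := PE N; rewrite /P muM//.
  move=> /fine_cvgP[_ /cvgrPdist_le/(_ _ e3)].
  apply: filterS => n /= En.
  have EF : E N `<=` \bigcup_k F k.
    by rewrite /E -bigcup_mkord => x [k _ Fkx]; exists k.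
  (* The error made by replacing the union by [E N] is uniform in [n]. *)
  have split_mu S : measurable S ->
      fine (mu (\bigcup_k F k `&` S)) =
      (fine (mu (E N `&` S)) + fine (mu ((\bigcup_k F k `\` E N) `&` S)))%R.
    move=> mS; rewrite -fineD ?fin//; try exact: measurableI.
      rewrite -measureU//.
      + by rewrite -setIUl setDUK.
      + exact: measurableI.
      + by apply: measurableI => //; exact: measurableD.
      + by rewrite setIACA setDIK set0I.
    by apply: measurableI => //; exact: measurableD.
  have mUE : measurable (\bigcup_k F k `\` E N) by exact: measurableD.
  have := split_mu _ (mTD n); have := split_mu setT measurableT.
  rewrite !setIT.
  have : (fine (mu ((\bigcup_k F k `\` E N) `&` iter n T @^-1` D)) <=
          fine (mu (\bigcup_k F k `\` E N)))%R.
    by rewrite fine_le ?fin// ?le_measure ?inE//; exact: measurableI.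
  have : (0 <= fine (mu ((\bigcup_k F k `\` E N) `&` iter n T @^-1` D)))%R.
    by rewrite fine_ge0.
  have : (0 <= fine (mu D) <= 1)%R.
    by rewrite fine_ge0//= -lee_fin fineK ?fin// probability_le1.
  move: EN En.
  set u := fine (mu (\bigcup_k F k)); set v := fine (mu (_ `\` _)).
  set w := fine (mu ((_ `\` _) `&` _)); set y := fine (mu (E N `&` _)).
  set x := fine (mu (_ `&` _)).
  set eN := fine (mu (E N)); set r := fine (mu D).
  rewrite !ler_norml => /andP[_ +] /andP[h1 h2] /andP[r0 r1] w0 wv uE xE.
  rewrite uE xE => h3.
  (* The quantity to bound is [(eN * r - y) + (v * r - w)]. The first bracket is at most [e / 3] in
     absolute value; [v * r] and [w] both lie between 0 and [v], which is at most [e / 3]. *)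
  have v0 : (0 <= v)%R by exact: le_trans wv.
  have vr : (v * r <= v)%R by rewrite ler_piMr.
  have vr0 : (0 <= v * r)%R by rewrite mulr_ge0.
  by apply/andP; split; lra.
Qed.
End MixingFromPiSystem.

(** * The doubling map and its two affine branches *)

Section DoublingMap.
Context (R : realType).
Local Open Scope ring_scope.

Local Notation lambda := (@lebesgue_measure R).
Local Notation mu := (@uniform_prob R 0 1 ltr01).

(** By uniqueness of Lebesgue measure: the pushforward under the affine map, scaled by [c], gives
    each half-open interval its length, since preimages of intervals are shorter by the factor
    [c]. *)
Lemma lebesgue_measure_affine (c b : R) (E : set R) : 0 < c -> measurable E ->
  (c%:E * lambda ((fun x : R => c * x + b)%R @^-1` E) = lambda E)%E.
Proof.
move=> c0 mE.
pose f : measurableTypeR R -> measurableTypeR R := fun x => c * x + b.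
have mf : measurable_fun setT f.
  by apply: measurable_funD => //; exact: measurable_funM.
suff : lambda E = pushforward (mscale (NngNum (ltW c0)) lambda) f E by move->.
apply: lebesgue_measure_unique => //.
move=> _ [[u v] _ <-]; rewrite /= /mscale/= /pushforward.
rewrite (_ : _ @^-1` _ = `](u - b) / c, (v - b) / c]%classic); last first.
  apply/seteqP; split => x /=; rewrite !in_itv/= /f ltr_pdivrMr// ler_pdivlMr//;
    by move=> /andP[? ?]; apply/andP; split; lra.
rewrite !lebesgue_measure_itv/= !lte_fin ltr_pM2r ?invr_gt0// ltrD2r.
case: ifPn => uv; last by rewrite mule0.
by rewrite -!EFinB -EFinM; congr EFin; field; rewrite gt_eqF.
Qed.

Lemma uniform_probE E : measurable E -> mu E = lambda (E `&` `[0, 1]).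
Proof.
move=> mE; rewrite /uniform_prob integral_uniform_pdf.
rewrite (eq_integral (fun=> 1%E)); last first.
  move=> x; rewrite inE/= => -[_]; rewrite in_itv/= /uniform_pdf => ->.
  by rewrite subr0 invr1.
by rewrite integral_cst ?mul1e//; exact: measurableI.
Qed.

(** The map acts on the whole line because [mu] is a probability on [R] carried by [0, 1]; values
    outside that interval affect only a null set. *)
Definition doubling (x : R) : R := if x < 2^-1 then 2 * x else 2 * x - 1.

Lemma measurable_doubling : measurable_fun [set: R] doubling.
Proof.
apply: measurable_fun_ifT => //=.
  exact: measurable_fun_ltr.
by apply: measurable_funB => //; exact: measurable_funM.
Qed.

Lemma measurable_preimage_doubling (E : set R) :
  measurable E -> measurable (doubling @^-1` E).
Proof.
by move=> mE; rewrite -[X in measurable X]setTI; exact: measurable_doubling.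
Qed.

(** Below 1/2 the map is multiplication by 2, so the left-hand set is, within [0, 1], the preimage
    of [[0, 2 * a[ & E] under a scaling that halves measure. *)
Lemma uniform_prob_doubling_left (a : R) (E : set R) :
  0 <= a <= 2^-1 -> measurable E ->
  mu (`[0, a[ `&` doubling @^-1` E) =
  (2^-1%:E * mu (`[0%R, (2 * a)%R[ `&` E))%E.
Proof.
move=> /andP[a0 a2] mE.
have mTE := measurable_preimage_doubling mE.
rewrite !uniform_probE; [|exact: measurableI..].
rewrite -[in RHS](@lebesgue_measure_affine 2 0 (_ `&` _ `&` _))//; last first.
  by do 2 apply: measurableI => //.
rewrite muleA -EFinM mulVf// mul1e; congr (lambda _).
apply/seteqP; split => x /=; rewrite !in_itv/= /doubling.
  move=> [[/andP[x0 xa]]]; rewrite ifT; last lra.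
  move=> ? /andP[_ x1]; rewrite addr0.
  by split; [split=> //|]; apply/andP; split; lra.
rewrite addr0 => -[[/andP[x0 xa] Ex] /andP[_ x1]].
rewrite ifT; last lra.
by split; [split=> //|]; apply/andP; split; lra.
Qed.

Lemma uniform_prob_doubling_right (a : R) (E : set R) :
  2^-1 <= a <= 1 -> measurable E ->
  mu (`[2^-1, a[ `&` doubling @^-1` E) =
  (2^-1%:E * mu (`[0%R, (2 * a - 1)%R[ `&` E))%E.
Proof.
move=> /andP[a0 a2] mE.
have mTE := measurable_preimage_doubling mE.
rewrite !uniform_probE; [|exact: measurableI..].
rewrite -[in RHS](@lebesgue_measure_affine 2 (-1) (_ `&` _ `&` _))//;
  last first.
  by do 2 apply: measurableI => //.
rewrite muleA -EFinM mulVf// mul1e; congr (lambda _).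
apply/seteqP; split => x /=; rewrite !in_itv/= /doubling.
  move=> [[/andP[x0 xa]]]; rewrite ifF; last lra.
  by move=> ? /andP[_ x1]; split; [split=> //|]; apply/andP; split; lra.
move=> [[/andP[x0 xa] Ex] /andP[_ x1]].
rewrite ifF; last lra.
by split; [split=> //|]; apply/andP; split; lra.
Qed.

Lemma uniform_prob_itvco (a b : R) : 0 <= a -> a <= b -> b <= 1 ->
  mu `[a, b[ = (b - a)%:E.
Proof.
move=> a0 ab b1; rewrite uniform_probE// setIidl; last first.
  by move=> x /=; rewrite !in_itv/= => /andP[? ?]; apply/andP; split; lra.
rewrite lebesgue_measure_itv/= lte_fin; case: ltgtP ab => // -> _.
by rewrite subrr.
Qed.

(** The complement of [[0, 1[] is null, as that interval already has measure 1. *)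
Lemma uniform_prob_setI01 (E : set R) :
  measurable E -> mu (`[0, 1[ `&` E) = mu E.
Proof.
move=> mE; rewrite [RHS](@measureDI _ _ _ mu E `[0, 1[)//.
rewrite [X in (X + _)%E](_ : _ = 0) ?add0e 1?setIC//.
have mC : measurable (~` `[0, 1[ : set R) by exact: measurableC.
apply: (@subset_measure0 _ _ _ mu _ (~` `[0, 1[)) => //.
  exact: measurableD.
have := @probability_setC _ _ _ mu `[0, 1[ (measurable_itv _).
by rewrite /= uniform_prob_itvco// subr0 subee.
Qed.

(** The left half [[0, 2^-1[] is contained in [[0, a[] and maps onto [[0, 1[], so it contributes
    half of [mu E]; the rest goes through the right branch. The case [a = 1] yields invariance of
    [mu]. *)
Lemma uniform_prob_doubling_split (a : R) (E : set R) :
  2^-1 <= a <= 1 -> measurable E ->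
  mu (`[0, a[ `&` doubling @^-1` E) =
  (2^-1%:E * mu E + 2^-1%:E * mu (`[0%R, (2 * a - 1)%R[ `&` E))%E.
Proof.
move=> a21 mE; have /andP[a2 a1] := a21.
have mTE := measurable_preimage_doubling mE.
rewrite (_ : `[0, a[%classic = `[0, 2^-1[ `|` `[2^-1, a[); last first.
  apply/seteqP; split => x /=; rewrite !in_itv/=; last first.
    by move=> [|] /andP[? ?]; apply/andP; split; lra.
  move=> /andP[? ?].
  by case: (ltP x 2^-1) => ?; [left|right]; apply/andP; split; lra.
rewrite setIUl measureU; [|exact: measurableI..|]; last first.
  rewrite setIACA (_ : _ `&` `[2^-1, a[ = set0) ?set0I//.
  apply/seteqP; split => x //=; rewrite !in_itv/=.
  by move=> -[/andP[? ?] /andP[? ?]]; lra.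
rewrite /= uniform_prob_doubling_left//; last by apply/andP; split; lra.
by rewrite uniform_prob_doubling_right// mulfV// uniform_prob_setI01.
Qed.

Lemma measure_preserving_doubling : measure_preserving mu doubling.
Proof.
split; first exact: measurable_doubling.
move=> C mC /=.
rewrite -uniform_prob_setI01; last exact: measurable_preimage_doubling.
rewrite uniform_prob_doubling_split//; last by apply/andP; split; lra.
rewrite (_ : 2 * 1 - 1 = 1); last by ring.
rewrite uniform_prob_setI01// -ge0_muleDl// -EFinD.
by rewrite (_ : 2^-1 + 2^-1 = 1) ?mul1e//; field.
Qed.

(** * Real-valued recurrences for correlations, and mixing *)

Local Notation p E := (fine (mu E)).

Lemma fine_uniform_prob (E : set R) : measurable E -> mu E = (p E)%:E.
Proof. by move=> mE; rewrite fineK// fin_num_measure. Qed.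

Lemma fine_uniform_prob_iterS_left n (a : R) (D : set R) :
  0 <= a <= 2^-1 -> measurable D ->
  p (`[0, a[ `&` iter n.+1 doubling @^-1` D) =
  2^-1 * p (`[0, 2 * a[ `&` iter n doubling @^-1` D).
Proof.
move=> a2 mD.
have mTD := measurable_iter_preimage measure_preserving_doubling n mD.
by rewrite preimage_iterS uniform_prob_doubling_left// fineM//
  fin_num_measure//; exact: measurableI.
Qed.

Lemma fine_uniform_prob_iterS_right n (a : R) (D : set R) :
  2^-1 <= a <= 1 -> measurable D ->
  p (`[2^-1, a[ `&` iter n.+1 doubling @^-1` D) =
  2^-1 * p (`[0, 2 * a - 1[ `&` iter n doubling @^-1` D).
Proof.
move=> a2 mD.
have mTD := measurable_iter_preimage measure_preserving_doubling n mD.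
by rewrite preimage_iterS uniform_prob_doubling_right// fineM//
  fin_num_measure//; exact: measurableI.
Qed.

Lemma fine_uniform_prob_iterS_split n (a : R) (D : set R) :
  2^-1 <= a <= 1 -> measurable D ->
  p (`[0, a[ `&` iter n.+1 doubling @^-1` D) =
  2^-1 * p D + 2^-1 * p (`[0, 2 * a - 1[ `&` iter n doubling @^-1` D).
Proof.
move=> a2 mD.
have mTD := measurable_iter_preimage measure_preserving_doubling n mD.
have mITD (c : R) : measurable (`[0, c[ `&` iter n doubling @^-1` D).
  exact: measurableI.
rewrite preimage_iterS uniform_prob_doubling_split//.
have -> : mu (iter n doubling @^-1` D) = mu D.
  exact: (measure_iter_preimage measure_preserving_doubling).
by rewrite (fine_uniform_prob mD) (fine_uniform_prob (mITD _)) -!EFinM -EFinD.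
Qed.

(** Induction on [n] for all [a] at once: by the recurrences, the discrepancy at [a] and time [n.+1]
    is exactly half the one at time [n] and endpoint [2 * a] or [2 * a - 1]. At time 0 both terms
    lie in [0, 1]. *)
Lemma doubling_discrepancy n (a : R) (D : set R) :
  0 <= a <= 1 -> measurable D ->
  `|p (`[0, a[ `&` iter n doubling @^-1` D) - a * p D| <= 1 / 2 ^+ n.
Proof.
elim: n a => [|n IHn] a /andP[a0 a1] mD.
  have p01 (E : set R) : measurable E -> 0 <= p E <= 1.
    move=> mE; rewrite fine_ge0//= -lee_fin -fine_uniform_prob//.
    exact: probability_le1.
  have /andP[x0 x1] : 0 <= p (`[0, a[ `&` D) <= 1.
    by apply: p01; exact: measurableI.
  have /andP[y0 y1] := p01 _ mD.
  have ay : a * p D <= 1 by rewrite mulr_ile1.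
  have ay0 : 0 <= a * p D by rewrite mulr_ge0.
  by rewrite expr0 divr1 ler_norml; apply/andP; split; lra.
have -> : 1 / 2 ^+ n.+1 = 2^-1 * (1 / 2 ^+ n) :> R.
  by rewrite exprS invfM mulrCA.
have [a2|a2] := leP a 2^-1.
  rewrite fine_uniform_prob_iterS_left ?a0//.
  rewrite (_ : _ - _ = 2^-1 *
      (p (`[0, 2 * a[ `&` iter n doubling @^-1` D) - (2 * a) * p D)).
    rewrite normrM ger0_norm// ler_pM2l// IHn//.
    by apply/andP; split; lra.
  by field.
rewrite fine_uniform_prob_iterS_split ?a1 ?andbT//; last exact: ltW.
rewrite (_ : _ - _ = 2^-1 *
    (p (`[0, 2 * a - 1[ `&` iter n doubling @^-1` D) - (2 * a - 1) * p D)).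
  rewrite normrM ger0_norm// ler_pM2l// IHn//.
  by apply/andP; split; lra.
by field.
Qed.

Lemma mixing_doubling : mixing mu doubling.
Proof.
apply: (mixing_pi_system measure_preserving_doubling
  (RGenInftyO.measurableE R)).
  move=> _ _ [x ->] [y ->]; exists (Num.min x y).
  by apply/seteqP; split => z /=; rewrite !in_itv/= lt_min => /andP.
move=> _ D [x ->] mD /=.
(* Clamping [x] to [0, 1] makes the half-line and [[0, a[] agree inside [[0, 1[], including the
   cases where [x] lies outside the unit interval. *)
pose a := Num.max 0 (Num.min x 1).
have a01 : 0 <= a <= 1 by rewrite le_max ge_max lexx ge_min lexx orbT ler01.
have muxE (E : set R) :
    measurable E -> mu (`]-oo, x[ `&` E) = mu (`[0, a[ `&` E).
  move=> mE; rewrite -uniform_prob_setI01; last exact: measurableI.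
  rewrite setIA (_ : _ `&` `]-oo, x[ = `[0, a[%classic)//.
  apply/seteqP; split => z /=; rewrite !in_itv/= lt_max lt_min.
    by move=> [/andP[-> ->] ->]; rewrite orbT.
  by move=> /andP[z0 /orP[|/andP[-> ->]]]; [rewrite ltNge z0|rewrite z0].
have -> : mu `]-oo, x[ = a%:E.
  have := muxE _ measurableT; rewrite !setIT => ->.
  rewrite uniform_prob_itvco ?subr0//.
  - by case/andP: a01.
  - by case/andP: a01.
have mTD n := measurable_iter_preimage measure_preserving_doubling n mD.
rewrite (fine_uniform_prob mD) -EFinM.
apply/fine_cvgP; split.
  by apply: nearW => n; rewrite fin_num_measure//; exact: measurableI.
apply/cvgrPdist_le => e e0.
have := near_infty_natSinv_expn_lt (PosNum e0); apply: filterS => n /ltW.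
rewrite distrC /= muxE.
  exact: le_trans (doubling_discrepancy n a01 mD).
exact: mTD.
Qed.

(** * The over-recurrent and under-recurrent sets *)

(* Writing [b n] and [c n] for the measures of [0, 1/3) & T^-n D and
   [0, 2/3) & T^-n D, the doubling map gives [b (n + 1) = c n / 2] and
   [c (n + 1) = mu D / 2 + b n / 2], whose fixed point for [mu D = 1/3] is
   [(1/9, 2/9)]; the side on which [(b 0, c 0)] lies is preserved. *)
Lemma over_recurrent_thirds n :
  9^-1 < p (`[0, 3^-1[ `&` iter n doubling @^-1` `[0, 3^-1[) /\
  2 / 9 < p (`[0, 2 / 3[ `&` iter n doubling @^-1` `[0, 3^-1[).
Proof.
have pB : p `[0, 3^-1[ = 3^-1 by rewrite uniform_prob_itvco /=; lra.
elim: n => [|n [IHb IHc]].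
  rewrite (_ : `[0, 2 / 3[ `&` _ = `[0, 3^-1[%classic); last first.
    apply/seteqP; split=> x /=; rewrite !in_itv/=; first by case.
    by move=> /andP[? ?]; split; apply/andP; split; lra.
  by rewrite setIid pB; split; lra.
rewrite fine_uniform_prob_iterS_left ?fine_uniform_prob_iterS_split ?pB//;
  try by apply/andP; split; lra.
rewrite (_ : 2 * 3^-1 = 2 / 3)// (_ : 2 * (2 / 3) - 1 = 3^-1); last by field.
by split; lra.
Qed.

(** The target again has measure 1/3, so the recurrence and its fixed point are unchanged; the
    initial values are now 0 and 1/6, below 1/9 and 2/9. *)
Lemma under_recurrent_thirds n :
  p (`[0, 3^-1[ `&` iter n doubling @^-1` `[2^-1, 5 / 6[) < 9^-1 /\
  p (`[0, 2 / 3[ `&` iter n doubling @^-1` `[2^-1, 5 / 6[) < 2 / 9.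
Proof.
have pA : p `[2^-1, 5 / 6[ = 3^-1 by rewrite uniform_prob_itvco /=; lra.
elim: n => [|n [IHb IHc]].
  rewrite (_ : `[0, 2 / 3[ `&` _ = `[2^-1, 2 / 3[%classic); last first.
    apply/seteqP; split=> x /=; rewrite !in_itv/=.
      by move=> [/andP[? ?] /andP[? ?]]; apply/andP; split; lra.
    by move=> /andP[? ?]; split; apply/andP; split; lra.
  rewrite (_ : `[0, 3^-1[ `&` _ = set0); last first.
    apply/seteqP; split=> x //=; rewrite !in_itv/=.
    by move=> [/andP[? ?] /andP[? ?]]; lra.
  by rewrite measure0 uniform_prob_itvco /=; lra.
rewrite fine_uniform_prob_iterS_left ?fine_uniform_prob_iterS_split ?pA//;
  try by apply/andP; split; lra.
rewrite (_ : 2 * 3^-1 = 2 / 3)// (_ : 2 * (2 / 3) - 1 = 3^-1); last by field.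
by split; lra.
Qed.

Lemma strictly_over_recurrent_doubling :
  strictly_over_recurrent mu doubling `[0, 3^-1[.
Proof.
move=> n _ /=.
have mT := measurable_iter_preimage measure_preserving_doubling n.
have mB : measurable (`[0, 3^-1[%classic : set R) by [].
rewrite uniform_prob_itvco; [|lra..].
rewrite fine_uniform_prob; last by apply: measurableI => //; exact: mT.
have [b _] := over_recurrent_thirds n.
by rewrite -EFinM lte_fin; lra.
Qed.

Lemma strictly_under_recurrent_doubling :
  strictly_under_recurrent mu doubling `[2^-1, 5 / 6[.
Proof.
(* Time 0 must be excluded, where the correlation would be 1/3. For positive times one step of the
   right branch carries [[2^-1, 5 / 6[] onto [[0, 2 / 3[], so the correlation is half of a quantity
   below 2/9. *)
move=> [//|n] _ /=.
have mT := measurable_iter_preimage measure_preserving_doubling n.+1.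
have mA : measurable (`[2^-1, 5 / 6[%classic : set R) by [].
rewrite fine_uniform_prob; last by apply: measurableI => //; exact: mT.
rewrite fine_uniform_prob_iterS_right//; last by apply/andP; split; lra.
rewrite uniform_prob_itvco; [|lra..].
rewrite (_ : 2 * (5 / 6) - 1 = 2 / 3); last by field.
have [_ c] := under_recurrent_thirds n.
by rewrite -EFinM lte_fin; lra.
Qed.

End DoublingMap.

Theorem theorem2p1 (R : realType) :
  exists (d : measure_display) (X : measurableType d)
         (mu : probability X R) (T : X -> X),
    [/\ measure_preserving mu T,
        mixing mu T
      & exists A B : set X,
          [/\ measurable A /\ 0 < mu A < 1,
              measurable B /\ 0 < mu B < 1,
              strictly_under_recurrent mu T A
            & strictly_over_recurrent mu T B]].
Proof.
exists _, (measurableTypeR R), (@uniform_prob R 0%R 1%R ltr01), (@doubling R).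
split; [exact: measure_preserving_doubling|exact: mixing_doubling|].
exists `[2^-1%R, (5 / 6)%R[%classic, `[0%R, 3^-1%R[%classic; split.
- split => //=; rewrite uniform_prob_itvco; [|lra..].
  by rewrite !lte_fin; apply/andP; split; lra.
- split => //=; rewrite uniform_prob_itvco; [|lra..].
  by rewrite !lte_fin; apply/andP; split; lra.
- exact: strictly_under_recurrent_doubling.
- exact: strictly_over_recurrent_doubling.
Qed.
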